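(* Let $(B^n,g_B)$ be a pseudo-Riemannian manifold of dimension $n\ge 2$, let $m\ge1$, let $s_1,\dots,s_m$ be positive integers, let $\lambda\in C^\infty(B)$ be a function, and let $b_1,\dots,b_m$ be smooth positive functions on $B$ satisfying $$\mathrm{Ric}_B=\lambda g_B+\sum_{i=1}^m\frac{s_i}{b_i}H_B^{b_i}.$$ Suppose that for each $i\in\{1,\dots,m\}$, $(F_i,g_{F_i})$ is an Einstein manifold of dimension $s_i$ with $\mathrm{Ric}_{F_i}=\mu_i g_{F_i}$, $\mu_i\in\mathbb{R}$. Then $$\sum_{i=1}^m s_i\frac{1}{b_i^2}A_i=\lambda\Big(n+\sum_{i=1}^m s_i\Big)-\tau,$$ where $$A_i:=b_i^2\left(\sum_{k=1}^m s_k\,g_B\Big(\frac{\mathrm{grad}_B b_i}{b_i},\frac{\mathrm{grad}_B b_k}{b_k}\Big)+\frac{\Delta_B b_i}{b_i}-\frac{\|\mathrm{grad}_B b_i\|_B^2}{b_i^2}+\lambda\right)-\mu_i$$ and $\tau$ is the scalar curvature of the multiply warped product $B\times_{b_1}F_1\times\cdots\times_{b_m}F_m$.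
   Context: All manifolds are semi-Riemannian (pseudo-Riemannian). The multiply warped product $B\times_{b_1}F_1\times\cdots\times_{b_m}F_m$ is the product manifold $B\times F_1\times\cdots\times F_m$ with metric $g=g_B\oplus b_1^2g_{F_1}\oplus\cdots\oplus b_m^2g_{F_m}$; functions on $B$ are lifted to the product by the projection. $\mathrm{Ric}$ denotes the Ricci tensor (sign such that round spheres have positive Ricci curvature). For $f\in C^\infty(B)$, $\mathrm{grad}_B f$ is the $g_B$-gradient, $H_B^f(X,Y)=XYf-(\nabla^B_XY)f$ the Hessian, $\Delta_B f$ the $g_B$-trace of $H_B^f$, and $\|\mathrm{grad}_B f\|_B^2=g_B(\mathrm{grad}_B f,\mathrm{grad}_B f)$ (possibly negative). *)

(* Defs.v *)
From mathcomp Require Import all_boot all_order all_algebra.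
From mathcomp Require Import all_classical all_reals all_analysis.

Set Implicit Arguments.
Unset Strict Implicit.
Unset Printing Implicit Defensive.

Import Order.TTheory GRing.Theory Num.Theory.
Import numFieldNormedType.Exports.
Local Open Scope classical_set_scope.
Local Open Scope ring_scope.

(* MathComp-Analysis has no manifolds.  Semi-Riemannian geometry is set up
   here classically: a manifold is a topological space with a smooth atlas,
   and a tensor field is the family of its component matrices in the charts,
   the coordinate i being the i-th column of a row vector. *)

Definition partial (R : realType) (n : nat) (i : 'I_n) (f : 'rV[R]_n -> R)
    (x : 'rV[R]_n) : R :=
  'D_(delta_mx 0 i) f x.

(* Meant for open U; the values of f outside U are irrelevant. *)
Fixpoint Ck_on (R : realType) (n k : nat) (U : set 'rV[R]_n)
    (f : 'rV[R]_n -> R) : Prop :=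
  {in U, continuous f} /\
  (if k is k'.+1 then
     forall i : 'I_n,
       (forall x, U x -> derivable f x (delta_mx 0 i)) /\
       Ck_on k' U (partial i f)
   else True).

Definition smooth_on (R : realType) (n : nat) (U : set 'rV[R]_n)
    (f : 'rV[R]_n -> R) : Prop :=
  forall k, Ck_on k U f.

(* Raw data of an atlas indexed by [chart]: the chart a is the map
   [to_coord a : dom a -> cod a], with inverse [param a]; both are total
   functions, meaningful only on [dom a] and [cod a].  [chart_at p] is a chart
   around p, in which tensors at the point p are evaluated. *)
Record charted_space (R : realType) (n : nat) := ChartedSpace {
  carrier :> topologicalType;
  chart : Type;
  dom : chart -> set carrier;
  cod : chart -> set 'rV[R]_n;
  to_coord : chart -> carrier -> 'rV[R]_n;
  param : chart -> 'rV[R]_n -> carrier;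
  chart_at : carrier -> chart }.

Arguments dom {R n c} _ _.
Arguments cod {R n c} _ _.
Arguments to_coord {R n c} _ _.
Arguments param {R n c} _ _.
Arguments chart_at {R n c} _.

Definition is_chart (R : realType) (n : nat) (M : charted_space R n)
    (a : chart M) : Prop :=
  [/\ open (dom a) /\ open (cod a),
      forall p, dom a p -> cod a (to_coord a p) /\ param a (to_coord a p) = p,
      forall x, cod a x -> dom a (param a x) /\ to_coord a (param a x) = x,
      {in dom a, continuous (to_coord a)} &
      {in cod a, continuous (param a)}].

Definition is_manifold (R : realType) (n : nat) (M : charted_space R n)
    : Prop :=
  [/\ hausdorff_space M,
      @second_countable M,
      forall p : M, dom (chart_at p) p,
      forall a : chart M, is_chart a &
      forall (a b : chart M) (k : 'I_n),
        smooth_on (cod a `&` param a @^-1` dom b)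
                  (fun x => to_coord b (param a x) 0 k)].

Definition smooth (R : realType) (n : nat) (M : charted_space R n)
    (f : M -> R) : Prop :=
  forall a : chart M, smooth_on (cod a) (f \o param a).

(* Components of a (0,2)-tensor field, as functions of the coordinates:
   [T a x i j] is T(d_i, d_j) at the point [param a x]. *)
Definition tensor2 (R : realType) (n : nat) (M : charted_space R n) :=
  chart M -> 'rV[R]_n -> 'M[R]_n.

Definition jacobian (R : realType) (n : nat) (M : charted_space R n)
    (a b : chart M) (x : 'rV[R]_n) : 'M[R]_n :=
  \matrix_(i, k) partial i (fun z => to_coord b (param a z) 0 k) x.

Definition transforms (R : realType) (n : nat) (M : charted_space R n)
    (T : tensor2 M) : Prop :=
  forall (a b : chart M) (x : 'rV[R]_n), cod a x -> dom b (param a x) ->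
    T a x = jacobian a b x *m T b (to_coord b (param a x))
            *m (jacobian a b x)^T.

(* A semi-Riemannian metric: the signature is arbitrary. *)
Definition is_metric (R : realType) (n : nat) (M : charted_space R n)
    (g : tensor2 M) : Prop :=
  [/\ transforms g,
      forall (a : chart M) (i j : 'I_n),
        smooth_on (cod a) (fun x => g a x i j),
      forall (a : chart M) x, cod a x -> (g a x)^T = g a x &
      forall (a : chart M) x, cod a x -> g a x \in unitmx].

(* [christoffel g a k i j] is Gamma^k_ij, for the Levi-Civita connection. *)
Definition christoffel (R : realType) (n : nat) (M : charted_space R n)
    (g : tensor2 M) (a : chart M) (k i j : 'I_n) (x : 'rV[R]_n) : R :=
  2^-1 * \sum_(l < n) invmx (g a x) k l *
    (partial i (fun z => g a z j l) x + partial j (fun z => g a z i l) x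
     - partial l (fun z => g a z i j) x).

(* The l-th component of R(d_i, d_j) d_k, where
   R(X, Y) = [nabla_X, nabla_Y] - nabla_[X, Y]. *)
Definition curvature (R : realType) (n : nat) (M : charted_space R n)
    (g : tensor2 M) (a : chart M) (l k i j : 'I_n) (x : 'rV[R]_n) : R :=
  partial i (christoffel g a l j k) x - partial j (christoffel g a l i k) x
  + \sum_(m < n) (christoffel g a l i m x * christoffel g a m j k x
                  - christoffel g a l j m x * christoffel g a m i k x).

(* Ric(Y, Z) is the trace of X |-> R(X, Y) Z. *)
Definition ricci (R : realType) (n : nat) (M : charted_space R n)
    (g : tensor2 M) : tensor2 M :=
  fun a x => \matrix_(j, k) \sum_(i < n) curvature g a i k i j x.

(* (X Y f - (nabla_X Y) f) on coordinate vector fields. *)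
Definition hessian (R : realType) (n : nat) (M : charted_space R n)
    (g : tensor2 M) (f : M -> R) : tensor2 M :=
  fun a x => \matrix_(i, j)
    (partial i (partial j (f \o param a)) x
     - \sum_(k < n) christoffel g a k i j x * partial k (f \o param a) x).

Definition at_point (R : realType) (n : nat) (M : charted_space R n)
    (T : tensor2 M) (p : M) : 'M[R]_n :=
  T (chart_at p) (to_coord (chart_at p) p).

Definition metric_trace (R : realType) (n : nat) (M : charted_space R n)
    (g T : tensor2 M) (p : M) : R :=
  \tr (invmx (at_point g p) *m at_point T p).

Definition laplacian (R : realType) (n : nat) (M : charted_space R n)
    (g : tensor2 M) (f : M -> R) : M -> R :=
  metric_trace g (hessian g f).

Definition scalar_curvature (R : realType) (n : nat) (M : charted_space R n)
    (g : tensor2 M) : M -> R :=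
  metric_trace g (ricci g).

(* Tangent vectors at p are given by their components in [chart_at p]. *)
Definition inner (R : realType) (n : nat) (M : charted_space R n)
    (g : tensor2 M) (p : M) (u v : 'rV[R]_n) : R :=
  (u *m at_point g p *m v^T) 0 0.

Definition grad (R : realType) (n : nat) (M : charted_space R n)
    (g : tensor2 M) (f : M -> R) (p : M) : 'rV[R]_n :=
  (\row_j partial j (f \o param (chart_at p)) (to_coord (chart_at p) p))
  *m invmx (at_point g p).

(* The product B * F_0 * ... * F_(m-1) with the atlas of product charts; its
   coordinates are row_mx x (\mxrow_i y_i). *)
Definition product_space (R : realType) (n m : nat) (s : 'I_m -> nat)
    (B : charted_space R n) (F : forall i : 'I_m, charted_space R (s i))
    : charted_space R (n + \sum_i s i) :=
  @ChartedSpace R (n + \sum_i s i)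
    (B * prod_topology (fun i => carrier (F i)))%type
    (chart B * (forall i, chart (F i)))%type
    (fun a => [set p | dom a.1 p.1 /\ forall i, dom (a.2 i) (p.2 i)])
    (fun a => [set z | cod a.1 (lsubmx z) /\
                       forall i, cod (a.2 i) (submxrow (rsubmx z) i)])
    (fun a p => row_mx (to_coord a.1 p.1) (\mxrow_i to_coord (a.2 i) (p.2 i)))
    (fun a z => (param a.1 (lsubmx z),
                 fun i => param (a.2 i) (submxrow (rsubmx z) i)))
    (fun p => (chart_at p.1, fun i => chart_at (p.2 i))).

(* g_B + b_0^2 g_(F_0) + ... + b_(m-1)^2 g_(F_(m-1)) *)
Definition warped_metric (R : realType) (n m : nat) (s : 'I_m -> nat)
    (B : charted_space R n) (F : forall i : 'I_m, charted_space R (s i))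
    (gB : tensor2 B) (gF : forall i : 'I_m, tensor2 (F i))
    (b : 'I_m -> B -> R) : tensor2 (product_space B F) :=
  fun a z =>
    block_mx (gB a.1 (lsubmx z)) 0 0
      (\mxdiag_i ((b i (param a.1 (lsubmx z))) ^+ 2 *:
                  gF i (a.2 i) (submxrow (rsubmx z) i))).

Definition is_einstein (R : realType) (n : nat) (M : charted_space R n)
    (g : tensor2 M) (mu : R) : Prop :=
  forall (a : chart M) x, cod a x -> ricci g a x = mu *: g a x.

(* Main.v *)
Require Import Defs.
From mathcomp Require Import all_boot all_order all_algebra.
From mathcomp Require Import all_classical all_reals all_analysis.
From mathcomp Require Import ring.
Import Order.TTheory GRing.Theory Num.Theory.
Import numFieldNormedType.Exports.
Local Open Scope ring_scope.

(** The identity is the trace of the hypothesis on [Ric_B], once the scalar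
curvature of the product is known.  Writing <.,.> for [g_B], every multiply
warped product satisfies

  tau = tau_B - 2 sum_i s_i (Lap b_i) / b_i + sum_i tau_{F_i} / b_i^2
        + sum_i s_i |grad b_i|^2 / b_i^2
        - sum_{i,k} s_i s_k <grad b_i, grad b_k> / (b_i b_k),

which is [scalar_curvature_warped].  Tracing the hypothesis gives
tau_B = n lambda + sum_i s_i (Lap b_i) / b_i, the Einstein condition gives
tau_{F_i} = mu_i s_i, and substituting both turns the formula for tau into the
claim.

The formula for tau is a computation in a product chart, whose coordinates
split into those of [B] and those of the [F_i].  The metric is block diagonal
and its [F_i]-block is b_i^2(x) g_{F_i}(y_i), a product of functions of separate
variables, so the only Christoffel symbols that do not vanish are those of the
factors and, with V_i = grad b_i,

  Gamma^k_{(ic)(id)} = - b_i V_i^k (g_{F_i})_{cd},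
  Gamma^{(ic)}_{k(id)} = Gamma^{(ic)}_{(id)k} = delta_{cd} (d_k b_i) / b_i.

The Ricci tensor is the trace sum_I R^I_{K I J}.  Each summand is found
separately ([curvatureB_B], [curvatureF_B], [curvatureB_F], [curvatureF_F_neq],
[curvatureF_F]), and summation over I yields

  Ric on the B-block   = Ric_B - sum_i (s_i / b_i) Hess b_i,
  Ric on the F_i-block = Ric_{F_i} + K_i g_{F_i},
  K_i = |V_i|^2 - b_i div V_i - b_i sum_k s_k <V_i, grad b_k> / b_k.

Only the diagonal blocks enter the trace, since the inverse metric is block
diagonal too.  What arises in K_i is the coordinate divergence
d_k V_i^k + Gamma^k_{kl} V_i^l; that it equals the trace of the Hessian
([coord_divE]) is the one place where the derivative of the inverse metric is
computed. *)

Set Implicit Arguments.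
Unset Strict Implicit.
Unset Printing Implicit Defensive.
Local Open Scope classical_set_scope.

(** * Directional derivatives *)

Section DirectionalDerivative.
Variables (R : realType) (V W : normedModType R).
Implicit Types (v z : V).

(** A directional derivative sees a function only along one line.  In a product
chart this freezes the variables that do not move. *)
Lemma eq_line_derive (f g : V -> R) v z :
  (forall h : R, f (h *: v + z) = g (h *: v + z)) -> 'D_v f z = 'D_v g z.
Proof.
move=> fg; have fgz : f z = g z by have := fg 0; rewrite scale0r add0r.
by apply: (congr1 (fun q : R -> R => lim (q @ 0^'))); apply/funext => h /=;
rewrite fg fgz.
Qed.

Lemma derive_comp_linear (f : W -> R) (L : V -> W) v z :
  linear L -> 'D_v (fun y => f (L y)) z = 'D_(L v) f (L z).
Proof.
move=> linL; apply: (congr1 (fun q : R -> R => lim (q @ 0^'))).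
by apply/funext => h /=; rewrite linL.
Qed.

Lemma derivable_comp_linear (f : W -> R) (L : V -> W) v z :
  linear L -> derivable f (L z) (L v) -> derivable (fun y => f (L y)) z v.
Proof.
move=> linL; rewrite /derivable => df.
have -> : (fun h : R => h^-1 *: (((fun y => f (L y)) \o shift z) (h *: v)
             - f (L z))) =
          (fun h : R => h^-1 *: ((f \o shift (L z)) (h *: L v) - f (L z))).
  by apply/funext => h /=; rewrite linL.
exact: df.
Qed.

Lemma derive_cst_line (f : V -> R) v z :
  (forall h : R, f (h *: v + z) = f z) -> 'D_v f z = 0.
Proof. by move=> /(@eq_line_derive f (cst (f z))) ->; exact: derive_cst. Qed.

Lemma derivable_prod (I : finType) (f : I -> V -> R) v z :
  (forall i, derivable (f i) z v) ->
  derivable (fun y => \prod_i f i y) z v.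
Proof.
move=> df; have -> : (fun y => \prod_i f i y) = \prod_i f i.
  by apply/funext => y; rewrite fct_prodE.
apply: (big_ind (fun g => derivable g z v)).
- exact: derivable_cst.
- by move=> f1 f2 d1 d2; exact: (@derivableM _ _ f1 f2 z v d1 d2).
- by move=> i _; exact: df.
Qed.

Lemma derivable_sum_fun (I : finType) (f : I -> V -> R) v z :
  (forall i, derivable (f i) z v) -> derivable (fun y => \sum_i f i y) z v.
Proof.
move=> df; have -> : (fun y => \sum_i f i y) = \sum_i f i.
  by apply/funext => y; rewrite fct_sumE.
apply: (big_ind (fun g => derivable g z v)).
- exact: derivable_cst.
- by move=> f1 f2 d1 d2; exact: (@derivableD _ _ _ f1 f2 z v d1 d2).
- by move=> i _; exact: df.
Qed.

Lemma derive_sum_fun n (f : 'I_n -> V -> R) v z :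
  (forall i, derivable (f i) z v) ->
  'D_v (fun y => \sum_i f i y) z = \sum_i 'D_v (f i) z.
Proof.
move=> df; rewrite -derive_sum//; congr (derive _ _ _).
by apply/funext => y; rewrite fct_sumE.
Qed.

Lemma derive_mul (f g : V -> R) v z :
  derivable f z v -> derivable g z v ->
  'D_v (fun y => f y * g y) z = f z * 'D_v g z + g z * 'D_v f z.
Proof. by move=> df dg; exact: (@deriveM _ _ f g z v df dg). Qed.

Lemma derivable_mul (f g : V -> R) v z :
  derivable f z v -> derivable g z v -> derivable (fun y => f y * g y) z v.
Proof. by move=> df dg; exact: (@derivableM _ _ f g z v df dg). Qed.

Lemma derive_cstM (f : V -> R) (k : R) v z :
  derivable f z v -> 'D_v (fun y => k * f y) z = k * 'D_v f z.
Proof.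
move=> df; rewrite (derive_mul (derivable_cst k z v) df).
by rewrite derive_cst mulr0 addr0.
Qed.

Lemma derivable_det k (A : V -> 'M[R]_k) v z :
  (forall i j, derivable (fun y => A y i j) z v) ->
  derivable (fun y => \det (A y)) z v.
Proof.
move=> dA; apply: derivable_sum_fun => t.
apply: derivable_mul; first exact: derivable_cst.
by apply: derivable_prod.
Qed.

(** Invertibility near [z] makes Cramer's formula, a quotient of determinants,
valid in a neighbourhood. *)
Lemma derivable_invmx k (A : V -> 'M[R]_k) v z :
  (\forall y \near z, A y \in unitmx) ->
  (forall i j, derivable (fun y => A y i j) z v) ->
  forall i j, derivable (fun y => invmx (A y) i j) z v.
Proof.
move=> uA dA i j.
apply: (@near_eq_derivable _ _ _
   (fun y => (\det (A y))^-1 * cofactor (A y) j i)).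
  by near=> y; rewrite /invmx (near uA y)// !mxE.
apply: derivable_mul.
  apply: derivableV; last exact: derivable_det.
  by have := nbhs_singleton uA; rewrite unitmxE unitfE.
apply: derivable_mul; first exact: derivable_cst.
apply: derivable_det => i' j'.
by under eq_fun do rewrite !mxE; exact: dA.
Unshelve. all: by end_near. Qed.

(** d(A^-1) = - A^-1 (dA) A^-1, from differentiating A^-1 A = 1. *)
Lemma derive_invmx k (A : V -> 'M[R]_k) v z :
  (\forall y \near z, A y \in unitmx) ->
  (forall i j, derivable (fun y => A y i j) z v) ->
  forall i j, 'D_v (fun y => invmx (A y) i j) z =
    - \sum_p \sum_q invmx (A z) i p * 'D_v (fun y => A y p q) z
                    * invmx (A z) q j.
Proof.
move=> uA dA.
have dP := derivable_invmx uA dA.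
pose dPm := \matrix_(i, j) 'D_v (fun y => invmx (A y) i j) z.
pose dAm := \matrix_(i, j) 'D_v (fun y => A y i j) z.
have uAz := nbhs_singleton uA.
have key : dPm *m A z = - (invmx (A z) *m dAm).
  apply/matrixP => i j; apply/eqP; rewrite -subr_eq0 !mxE opprK; apply/eqP.
  transitivity ('D_v (fun y => \sum_q invmx (A y) i q * A y q j) z).
    rewrite derive_sum_fun; last by move=> q; exact: derivable_mul.
    rewrite -big_split; apply: eq_bigr => q _.
    by rewrite /= derive_mul// !mxE addrC; congr (_ + _); exact: mulrC.
  rewrite (@near_eq_derive _ _ _ _ (cst ((i == j)%:R : R))) ?derive_cst//.
  near=> y; have uAy : A y \in unitmx by near: y.
  have /matrixP/(_ i j) := mulVmx uAy.
  by rewrite !mxE.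
move=> i j.
have -> : 'D_v (fun y => invmx (A y) i j) z = dPm i j by rewrite mxE.
rewrite -(mulmxK uAz dPm) key mulNmx !mxE; congr (- _).
rewrite exchange_big /=; apply: eq_bigr => q _; rewrite mxE mulr_suml.
by apply: eq_bigr => p _; rewrite mxE.
Unshelve. all: by end_near. Qed.

End DirectionalDerivative.

(** * Smooth functions and charts *)

Lemma smooth_on_derivable (R : realType) n (U : set 'rV[R]_n) f x i :
  smooth_on U f -> U x -> derivable f x (delta_mx 0 i).
Proof. by move=> /(_ 1%N)[_ /(_ i)[+ _]]; exact. Qed.

Lemma smooth_on_partial (R : realType) n (U : set 'rV[R]_n) f i :
  smooth_on U f -> smooth_on U (partial i f).
Proof. by move=> sf k; have [_ /(_ i)[]] := sf k.+1. Qed.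

Lemma cod_chart_at (R : realType) k (M : charted_space R k) (p : M) :
  is_manifold M -> cod (chart_at p) (to_coord (chart_at p) p).
Proof. by case=> _ _ dM /(_ (chart_at p))[_ /(_ p (dM p))[]]. Qed.

Lemma param_chart_at (R : realType) k (M : charted_space R k) (p : M) :
  is_manifold M -> param (chart_at p) (to_coord (chart_at p) p) = p.
Proof. by case=> _ _ dM /(_ (chart_at p))[_ /(_ p (dM p))[]]. Qed.

(** * Block matrices *)

Section BlockSums.
Variables (R : pzRingType) (n m : nat) (s : 'I_m -> nat).
Local Notation fI i a := (rshift n (tagnat.Rank i a)).

Lemma big_block_ord (f : 'I_(n + \sum_i s i) -> R) :
  \sum_p f p = \sum_(c < n) f (lshift _ c) + \sum_i \sum_(c < s i) f (fI i c).
Proof.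
rewrite big_split_ord /=; congr (_ + _).
rewrite sig_big_dep /= (reindex _ tagnat.sig_bij_on) /=.
by apply: eq_bigr => l _; rewrite -[LHS]/(f (rshift n l)) -{1}(tagnat.sig2K l).
Qed.

Lemma mxdiag_Rank (D : forall i, 'M[R]_(s i)) i (a c : 'I_(s i)) :
  (\mxdiag_i D i) (tagnat.Rank i a) (tagnat.Rank i c) = D i a c.
Proof.
by have /matrixP/(_ a c) := submxblock_diag D i; rewrite mxE.
Qed.

Lemma mxdiag_Rank_neq (D : forall i, 'M[R]_(s i)) i j
    (a : 'I_(s i)) (c : 'I_(s j)) :
  i != j -> (\mxdiag_i D i) (tagnat.Rank i a) (tagnat.Rank j c) = 0.
Proof.
move=> ij; have : submxblock (\mxdiag_i D i) i j = 0.
  by rewrite /mxdiag mxblockK (negbTE ij).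
by move=> /matrixP/(_ a c); rewrite mxE [RHS]mxE.
Qed.

End BlockSums.

Lemma mulmx_mxdiag (R : pzRingType) m (s : 'I_m -> nat)
    (C D : forall i, 'M[R]_(s i)) :
  (\mxdiag_i C i) *m (\mxdiag_i D i) = \mxdiag_i (C i *m D i).
Proof.
rewrite {2}/mxdiag mul_mxdiag_mxblock /mxdiag; apply: eq_mxblock => i j.
case: eqVneq => [<-|_]; last by rewrite mulmx0.
by rewrite !conform_mx_id.
Qed.

Lemma sum_delta (R : pzRingType) k (c : 'I_k) (f : 'I_k -> R) :
  \sum_e (e == c)%:R * f e = f c.
Proof.
rewrite (bigD1 c)//= eqxx mul1r big1 ?addr0// => e ec.
by rewrite (negbTE ec) mul0r.
Qed.

Lemma invmx_uniq (R : comUnitRingType) k (A C : 'M[R]_k) :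
  A *m C = 1%:M -> invmx A = C.
Proof.
by move=> ACE; have [uA _] := mulmx1_unit ACE; rewrite -[LHS]mulmx1 -ACE mulKmx.
Qed.

(** The algebra behind div (grad f) = tr (Hess f).  Here [P] stands for the
inverse metric, [d c i j] for the derivative d_c g_{ij}, [bb] for df, [h k l] for
d_k d_l f, and the first term of the left-hand side is d_k P_{kl} as computed by
the rule for the derivative of an inverse.  Both sides reduce to
- X + Y / 2 plus the second derivatives, with X = P^{kp} (d_k g_{pq}) V^q and
Y = P^{kp} (d_q g_{kp}) V^q. *)
Lemma divergence_grad_algebra (R : realFieldType) n (P : 'M[R]_n)
    (d : 'I_n -> 'I_n -> 'I_n -> R) (bb : 'I_n -> R) (h : 'I_n -> 'I_n -> R)
    (symP : forall i j, P i j = P j i)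
    (symd : forall c i j, d c i j = d c j i) :
  let Gam k i j := 2^-1 * \sum_l P k l * (d i j l + d j i l - d l i j) in
  let V k := \sum_l P k l * bb l in
  \sum_k (\sum_l (- (\sum_p \sum_q P k p * d k p q * P q l) * bb l
                  + P k l * h k l)
          + \sum_l Gam k k l * V l)
  = \sum_k \sum_l P k l * (h l k - \sum_e Gam e l k * bb e).
Proof.
move=> Gam V.
pose X := \sum_k \sum_p \sum_q P k p * d k p q * V q.
pose Y := \sum_k \sum_p \sum_q P k p * d q k p * V q.
have E1 : \sum_k \sum_l - (\sum_p \sum_q P k p * d k p q * P q l) * bb l = - X.
  rewrite -sumrN; apply: eq_bigr => k _; rewrite -[RHS]mulN1r mulr_sumr.
  under [RHS]eq_bigr do rewrite mulr_sumr; rewrite /V.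
  under [RHS]eq_bigr do under eq_bigr do rewrite mulr_sumr mulr_sumr.
  under [RHS]eq_bigr do rewrite exchange_big /=.
  rewrite [RHS]exchange_big /=; apply: eq_bigr => l _.
  rewrite mulNr mulr_suml -sumrN; apply: eq_bigr => p _.
  by rewrite mulr_suml -sumrN; apply: eq_bigr => q _; ring.
have EX1 : \sum_k \sum_l \sum_p P k p * d k l p * V l = X.
  apply: eq_bigr => k _; rewrite exchange_big /=; apply: eq_bigr => p _.
  by apply: eq_bigr => q _; rewrite (symd k q).
have EX2 : \sum_k \sum_l \sum_p P k p * d p k l * V l = X.
  under eq_bigr do rewrite exchange_big /=.
  rewrite exchange_big /=; apply: eq_bigr => k _; apply: eq_bigr => p _.
  by apply: eq_bigr => q _; rewrite (symP p k).
have EY : \sum_k \sum_l \sum_p P k p * d l k p * V l = Y.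
  by apply: eq_bigr => k _; rewrite exchange_big.
have E2 : \sum_k \sum_l Gam k k l * V l = 2^-1 * Y.
  transitivity (2^-1 * (\sum_k \sum_l \sum_p P k p * d k l p * V l
      + \sum_k \sum_l \sum_p P k p * d l k p * V l
      - \sum_k \sum_l \sum_p P k p * d p k l * V l)); last first.
    by rewrite EX1 EX2 EY; ring.
  rewrite -sumrN -!big_split /= mulr_sumr; apply: eq_bigr => k _.
  rewrite -sumrN -!big_split /= mulr_sumr; apply: eq_bigr => l _.
  rewrite -sumrN -!big_split /= -mulrA mulr_suml; congr (_ * _).
  by apply: eq_bigr => p _; ring.
have EG i j : \sum_e Gam e i j * bb e =
    2^-1 * \sum_l (d i j l + d j i l - d l i j) * V l.
  rewrite /Gam; under eq_bigr do rewrite -mulrA mulr_suml.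
  rewrite -mulr_sumr exchange_big /=; congr (_ * _); apply: eq_bigr => l _.
  by rewrite /V mulr_sumr; apply: eq_bigr => e _; rewrite (symP e); ring.
have E3 : \sum_k \sum_l P k l * \sum_e Gam e l k * bb e = X - 2^-1 * Y.
  transitivity (2^-1 * (X + \sum_k \sum_p \sum_q P k p * d p k q * V q - Y)).
    rewrite -sumrN -!big_split /= mulr_sumr; apply: eq_bigr => k _.
    rewrite -sumrN -!big_split /= mulr_sumr; apply: eq_bigr => l _.
    rewrite EG mulrCA; congr (_ * _); rewrite mulr_sumr.
    rewrite -sumrN -!big_split /=; apply: eq_bigr => q _.
    by rewrite (symd q l k); ring.
  have -> : \sum_k \sum_p \sum_q P k p * d p k q * V q = X.
    rewrite -EX2; apply: eq_bigr => k _; rewrite exchange_big /=.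
    by [].
  by field.
transitivity (- X + 2^-1 * Y + \sum_k \sum_l P k l * h k l).
  rewrite -E1 -E2 -!big_split /=; apply: eq_bigr => k _.
  by rewrite big_split /=; ring.
transitivity (\sum_k \sum_l P k l * h l k - (X - 2^-1 * Y)).
  rewrite (_ : \sum_k \sum_l P k l * h k l = \sum_k \sum_l P k l * h l k).
    by ring.
  rewrite exchange_big /=; apply: eq_bigr => k _; apply: eq_bigr => l _.
  by rewrite symP.
rewrite -E3 -sumrN -big_split /=; apply: eq_bigr => k _.
rewrite -sumrN -big_split /=; apply: eq_bigr => l _.
by rewrite mulrBr.
Qed.

(** * Coordinates of a product chart *)

Section WarpedProduct.
Variables (R : realType) (n m : nat) (s : 'I_m -> nat).
Variables (B : charted_space R n) (gB : tensor2 B).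
Variables (F : forall i : 'I_m, charted_space R (s i)).
Variables (gF : forall i : 'I_m, tensor2 (F i)) (b : 'I_m -> B -> R).
Arguments gF : clear implicits.
Hypotheses (hB : is_manifold B) (hgB : is_metric gB).
Hypotheses (hF : forall i, is_manifold (F i)).
Hypotheses (hgF : forall i, is_metric (gF i)).
Hypotheses (hb : forall i, smooth (b i)) (hb0 : forall i p, b i p != 0).
Variable a : chart (product_space B F).

(* In the chart [a], [bI c] is a coordinate of the base, [fI i c] the c-th
   coordinate of the i-th fibre, and [fib z i] the F_i-component of [z]. *)
Local Notation N := (\sum_i s i)%N.
Local Notation bI c := (lshift N c).
Local Notation fI i c := (rshift n (tagnat.Rank i c)).
Local Notation fib z i := (submxrow (rsubmx z) i).
Local Notation G := (warped_metric gB gF b a).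
Local Notation w i := (b i \o param a.1).
Implicit Types z : 'rV[R]_(n + N).

Lemma linear_fib i : linear (fun z => fib z i).
Proof. by move=> h u v; apply/rowP => j; rewrite !mxE. Qed.

Lemma linear_base : linear (fun z : 'rV[R]_(n + N) => lsubmx z).
Proof. by move=> h u v; apply/rowP => j; rewrite !mxE. Qed.

Lemma lsubmx_base c :
  lsubmx (delta_mx 0 (bI c) : 'rV[R]_(n + N)) = delta_mx 0 c.
Proof. by apply/rowP => j; rewrite !mxE (inj_eq (@lshift_inj _ _)). Qed.

Lemma lsubmx_fib i c : lsubmx (delta_mx 0 (fI i c) : 'rV[R]_(n + N)) = 0.
Proof. by apply/rowP => j; rewrite !mxE eq_lrshift andbF. Qed.

Lemma fib_base i c : fib (delta_mx 0 (bI c) : 'rV[R]_(n + N)) i = 0.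
Proof. by apply/rowP => j; rewrite !mxE eq_rlshift andbF. Qed.

Lemma fib_fib i c : fib (delta_mx 0 (fI i c) : 'rV[R]_(n + N)) i = delta_mx 0 c.
Proof.
apply/rowP => j; rewrite !mxE (inj_eq (@rshift_inj _ _)).
by rewrite -[X in _ && X]val_eqE tagnat.eq_Rank !eqxx /= val_eqE.
Qed.

Lemma fib_fib_neq i j c :
  i != j -> fib (delta_mx 0 (fI i c) : 'rV[R]_(n + N)) j = 0.
Proof.
move=> ij; apply/rowP => k; rewrite !mxE (inj_eq (@rshift_inj _ _)).
by rewrite -[X in _ && X]val_eqE tagnat.eq_Rank eq_sym (negbTE ij) andbF.
Qed.

Lemma base_line z v (h : R) :
  lsubmx v = 0 -> lsubmx (h *: v + z) = lsubmx z.
Proof. by move=> v0; rewrite linear_base v0 scaler0 add0r. Qed.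

Lemma fib_line i z v (h : R) :
  fib v i = 0 -> fib (h *: v + z) i = fib z i.
Proof. by move=> v0; rewrite linear_fib v0 scaler0 add0r. Qed.

Lemma partial_base (u : 'rV[R]_n -> R) c z :
  partial (bI c) (fun y => u (lsubmx y)) z = partial c u (lsubmx z).
Proof.
by rewrite /partial (derive_comp_linear _ _ _ linear_base) lsubmx_base. Qed.

Lemma partial_base_fib (u : 'rV[R]_n -> R) i c z :
  partial (fI i c) (fun y => u (lsubmx y)) z = 0.
Proof.
by apply: derive_cst_line => h; rewrite base_line// lsubmx_fib.
Qed.

Lemma partial_fib i (f : 'rV[R]_(s i) -> R) c z :
  partial (fI i c) (fun y => f (fib y i)) z = partial c f (fib z i).
Proof.
by rewrite /partial (derive_comp_linear _ _ _ (linear_fib i)) fib_fib. Qed.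

Lemma partial_base_mul (u : 'rV[R]_n -> R) i (f : 'rV[R]_(s i) -> R) c z :
  derivable u (lsubmx z) (delta_mx 0 c) ->
  partial (bI c) (fun y => u (lsubmx y) * f (fib y i)) z =
  partial c u (lsubmx z) * f (fib z i).
Proof.
move=> du; rewrite /partial (@eq_line_derive _ _ _
  (fun y => f (fib z i) * u (lsubmx y))) => [|h]; last first.
  by rewrite (fib_line _ _ (fib_base _ _)) mulrC.
rewrite (derive_cstM (f := fun y => u (lsubmx y))).
  by rewrite -/(partial _ _ _) partial_base mulrC.
by apply: (derivable_comp_linear linear_base); rewrite lsubmx_base.
Qed.

Lemma partial_fib_mul (u : 'rV[R]_n -> R) i (f : 'rV[R]_(s i) -> R) c z :
  derivable f (fib z i) (delta_mx 0 c) ->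
  partial (fI i c) (fun y => u (lsubmx y) * f (fib y i)) z =
  u (lsubmx z) * partial c f (fib z i).
Proof.
move=> df; rewrite /partial (@eq_line_derive _ _ _
  (fun y => u (lsubmx z) * f (fib y i))) => [|h]; last first.
  by rewrite (base_line _ _ (lsubmx_fib _)).
rewrite (derive_cstM (f := fun y => f (fib y i))).
  by rewrite -/(partial _ _ _) partial_fib.
by apply: (derivable_comp_linear (linear_fib i)); rewrite fib_fib.
Qed.

Lemma partial_fib_neq_mul (u : 'rV[R]_n -> R) i (f : 'rV[R]_(s i) -> R) j c z :
  j != i ->
  partial (fI j c) (fun y => u (lsubmx y) * f (fib y i)) z = 0.
Proof.
move=> ji; apply: derive_cst_line => h.
by rewrite (base_line _ _ (lsubmx_fib _)) (fib_line _ _ (fib_fib_neq _ ji)).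
Qed.

Lemma continuous_fib i : continuous (fun z => fib z i).
Proof.
move=> u A /nbhs_ballP[e /= e0 eA].
apply/nbhs_ballP; exists e => //= v [_ uv]; apply: eA; split => // k j.
by apply: (le_lt_trans _ (uv k (fI i j))); rewrite !mxE.
Qed.

(** Christoffel symbols are differentiated below, so formulas for them are
needed on a neighbourhood and not only at the point. *)
Lemma near_cod z : cod a z -> \forall y \near z, cod a y.
Proof.
move=> [zB zF]; have [_ _ _ cB _] := hB.
have [[_ oB] _ _ _ _] := cB a.1.
have nB : \forall y \near z, cod a.1 (lsubmx y).
  exact: (continuous_lsubmx (open_nbhs_nbhs (conj oB zB))).
have nF : \forall y \near z, forall i, cod (a.2 i) (fib y i).
  apply: (@filter_forall _ _ (fun i y => cod (a.2 i) (fib y i)) (nbhs z)) => i.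
  have [_ _ _ cF _] := hF i.
  have [[_ oF] _ _ _ _] := cF (a.2 i).
  exact: (continuous_fib (open_nbhs_nbhs (conj oF (zF i)))).
by near=> y; split; near: y.
Unshelve. all: by end_near. Qed.

Lemma eq_partial_on k (f g : 'rV[R]_(n + N) -> R) z :
  cod a z -> (forall y, cod a y -> f y = g y) -> partial k f z = partial k g z.
Proof.
move=> az fg; apply: near_eq_derive.
by apply: filterS (near_cod az) => y; exact: fg.
Qed.

Local Notation Gam := (christoffel (warped_metric gB gF b) a).

(** * The warped metric, its inverse and its first derivatives *)

Lemma warpBB c d z : G z (bI c) (bI d) = gB a.1 (lsubmx z) c d.
Proof. by rewrite /warped_metric block_mxEul. Qed.

Lemma warpBF c i d z : G z (bI c) (fI i d) = 0.
Proof. by rewrite /warped_metric block_mxEur mxE. Qed.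

Lemma warpFB c i d z : G z (fI i d) (bI c) = 0.
Proof. by rewrite /warped_metric block_mxEdl mxE. Qed.

Lemma warpFF i c d z : G z (fI i c) (fI i d) =
  w i (lsubmx z) ^+ 2 * gF i (a.2 i) (fib z i) c d.
Proof. by rewrite /warped_metric block_mxEdr mxdiag_Rank mxE. Qed.

Lemma warpFF_neq i c j d z : i != j -> G z (fI i c) (fI j d) = 0.
Proof. by move=> ij; rewrite /warped_metric block_mxEdr mxdiag_Rank_neq. Qed.

Lemma fun_warpBB c d :
  (fun y => G y (bI c) (bI d)) = (fun y => gB a.1 (lsubmx y) c d).
Proof. by apply/funext => y; exact: warpBB. Qed.

Lemma fun_warpFF i c d : (fun y => G y (fI i c) (fI i d)) =
  (fun y => w i (lsubmx y) ^+ 2 * gF i (a.2 i) (fib y i) c d).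
Proof. by apply/funext => y; exact: warpFF. Qed.

Lemma unitB x : cod a.1 x -> gB a.1 x \in unitmx.
Proof. by have [_ _ _] := hgB; exact. Qed.

Lemma unitF i y : cod (a.2 i) y -> gF i (a.2 i) y \in unitmx.
Proof. by have [_ _ _] := hgF i; exact. Qed.

Lemma symB x c d : cod a.1 x -> gB a.1 x c d = gB a.1 x d c.
Proof.
by have [_ _ + _] := hgB => /(_ a.1 x)/[apply] /matrixP/(_ d c); rewrite mxE. Qed.

Lemma symF i y c d : cod (a.2 i) y ->
  gF i (a.2 i) y c d = gF i (a.2 i) y d c.
Proof.
by have [_ _ + _] := hgF i => /(_ (a.2 i) y)/[apply] /matrixP/(_ d c); rewrite mxE.
Qed.

Lemma invmx_warped z : cod a z ->
  invmx (G z) = block_mx (invmx (gB a.1 (lsubmx z))) 0 0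
    (\mxdiag_i ((w i (lsubmx z) ^+ 2)^-1 *: invmx (gF i (a.2 i) (fib z i)))).
Proof.
move=> [zB zF]; apply: invmx_uniq; rewrite /warped_metric mulmx_block.
rewrite !(mulmx0, mul0mx, addr0, add0r) mulmxV ?unitB// mulmx_mxdiag.
rewrite [X in block_mx _ _ _ X](_ : _ = 1%:M) -?scalar_mx_block//.
rewrite -mxdiagZ; apply: eq_mxdiag => i.
rewrite -scalemxAl -scalemxAr scalerA mulfV ?expf_neq0//.
by rewrite scale1r mulmxV// unitF.
Qed.

Lemma invmx_warpBB k l z : cod a z ->
  invmx (G z) (bI k) (bI l) = invmx (gB a.1 (lsubmx z)) k l.
Proof. by move=> az; rewrite (invmx_warped az) block_mxEul. Qed.

Lemma invmx_warpBF k i l z : cod a z -> invmx (G z) (bI k) (fI i l) = 0.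
Proof. by move=> az; rewrite (invmx_warped az) block_mxEur mxE. Qed.

Lemma invmx_warpFB k i l z : cod a z -> invmx (G z) (fI i l) (bI k) = 0.
Proof. by move=> az; rewrite (invmx_warped az) block_mxEdl mxE. Qed.

Lemma invmx_warpFF i k l z : cod a z -> invmx (G z) (fI i k) (fI i l) =
  (w i (lsubmx z) ^+ 2)^-1 * invmx (gF i (a.2 i) (fib z i)) k l.
Proof.
by move=> az; rewrite (invmx_warped az) block_mxEdr mxdiag_Rank mxE.
Qed.

Lemma invmx_warpFF_neq i k j l z : cod a z -> i != j ->
  invmx (G z) (fI i k) (fI j l) = 0.
Proof.
by move=> az ij; rewrite (invmx_warped az) block_mxEdr mxdiag_Rank_neq.
Qed.

(** * Christoffel symbols of the warped metric *)

(** As the inverse metric is block diagonal, an upper index in one block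
contracts with that block alone. *)
Lemma christoffelB k I J z : cod a z ->
  Gam (bI k) I J z = 2^-1 * \sum_l invmx (gB a.1 (lsubmx z)) k l *
    (partial I (fun y => G y J (bI l)) z + partial J (fun y => G y I (bI l)) z
     - partial (bI l) (fun y => G y I J) z).
Proof.
move=> az; rewrite /christoffel big_block_ord [X in _ + X]big1 ?addr0.
  by congr (_ * _); apply: eq_bigr => l _; rewrite (invmx_warpBB _ _ az).
by move=> i _; apply: big1 => c _; rewrite (invmx_warpBF _ _ az) mul0r.
Qed.

Lemma christoffelF i k I J z : cod a z ->
  Gam (fI i k) I J z = 2^-1 * \sum_l (w i (lsubmx z) ^+ 2)^-1 *
    invmx (gF i (a.2 i) (fib z i)) k l *
    (partial I (fun y => G y J (fI i l)) z + partial J (fun y => G y I (fI i l)) z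
     - partial (fI i l) (fun y => G y I J) z).
Proof.
move=> az; rewrite /christoffel big_block_ord big1 ?add0r.
  rewrite (bigD1 i)//= [X in _ + X]big1 ?addr0.
    congr (_ * _); apply: eq_bigr => l _.
    by rewrite (invmx_warpFF _ _ az).
  move=> j ji; apply: big1 => c _.
  by rewrite (invmx_warpFF_neq _ _ az) ?mul0r// eq_sym.
by move=> c _; rewrite (invmx_warpFB _ _ az) mul0r.
Qed.

Lemma partial_cst k (f : 'rV[R]_(n + N) -> R) z c :
  (forall y, f y = c) -> partial k f z = 0.
Proof. by move=> fc; apply: derive_cst_line => h; rewrite !fc. Qed.

Lemma partial_cst_on k (f : 'rV[R]_(n + N) -> R) z c :
  cod a z -> (forall y, cod a y -> f y = c) -> partial k f z = 0.
Proof.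
by move=> az fc; rewrite (eq_partial_on k az (g := cst c))// /partial derive_cst.
Qed.

Lemma partialB_warpBB e c d z : partial (bI e) (fun y => G y (bI c) (bI d)) z =
  partial e (fun x => gB a.1 x c d) (lsubmx z).
Proof.
by rewrite fun_warpBB; exact: (partial_base (fun x => gB a.1 x c d)). Qed.

Lemma partialF_warpBB i e c d z :
  partial (fI i e) (fun y => G y (bI c) (bI d)) z = 0.
Proof.
by rewrite fun_warpBB; exact: (partial_base_fib (fun x => gB a.1 x c d)). Qed.

Lemma partial_warpBF k c i d z : partial k (fun y => G y (bI c) (fI i d)) z = 0.
Proof. by apply: partial_cst => y; exact: warpBF. Qed.

Lemma partial_warpFB k c i d z : partial k (fun y => G y (fI i d) (bI c)) z = 0.
Proof. by apply: partial_cst => y; exact: warpFB. Qed.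

Lemma partial_warpFF_neq k i c j d z : i != j ->
  partial k (fun y => G y (fI i c) (fI j d)) z = 0.
Proof. by move=> ij; apply: partial_cst => y; exact: warpFF_neq. Qed.

Lemma derivable_warp i x e : cod a.1 x -> derivable (w i) x (delta_mx 0 e).
Proof.
by move=> ax; have hba := hb i a.1; exact: smooth_on_derivable hba ax. Qed.

Lemma derivable_gF i y c d e : cod (a.2 i) y ->
  derivable (fun x => gF i (a.2 i) x c d) y (delta_mx 0 e).
Proof.
move=> ay; have [_ /(_ (a.2 i) c d) sF _ _] := hgF i.
exact: smooth_on_derivable sF ay.
Qed.

Lemma derivable_gB x c d e : cod a.1 x ->
  derivable (fun x => gB a.1 x c d) x (delta_mx 0 e).
Proof.
move=> ax; have [_ /(_ a.1 c d) sB _ _] := hgB.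
exact: smooth_on_derivable sB ax.
Qed.

Lemma partialB_warpFF e i c d z : cod a z ->
  partial (bI e) (fun y => G y (fI i c) (fI i d)) z =
  2 * w i (lsubmx z) * partial e (w i) (lsubmx z) * gF i (a.2 i) (fib z i) c d.
Proof.
move=> [az _]; rewrite fun_warpFF.
have dw := derivable_warp (i := i) (e := e) az.
rewrite (partial_base_mul (u := fun x => w i x ^+ 2)
   (fun y => gF i (a.2 i) y c d)).
  by rewrite /partial (derive_mul dw dw); ring.
exact: (derivable_mul dw dw).
Qed.

Lemma partialF_warpFF i e c d z : cod a z ->
  partial (fI i e) (fun y => G y (fI i c) (fI i d)) z =
  w i (lsubmx z) ^+ 2 * partial e (fun y => gF i (a.2 i) y c d) (fib z i).
Proof.
move=> [_ az]; rewrite fun_warpFF.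
rewrite (partial_fib_mul (fun x => w i x ^+ 2)
   (f := fun y => gF i (a.2 i) y c d))//.
exact: derivable_gF.
Qed.

Lemma partialF_warpFF_neq j e i c d z : j != i ->
  partial (fI j e) (fun y => G y (fI i c) (fI i d)) z = 0.
Proof.
move=> ji; rewrite fun_warpFF.
exact: (partial_fib_neq_mul (fun x => w i x ^+ 2) (fun y => gF i (a.2 i) y c d)).
Qed.

Definition coord_grad i k (x : 'rV[R]_n) : R :=
  \sum_l invmx (gB a.1 x) k l * partial l (w i) x.

Lemma christoffelB_BB k c d z : cod a z ->
  Gam (bI k) (bI c) (bI d) z = christoffel gB a.1 k c d (lsubmx z).
Proof.
move=> az; rewrite christoffelB// /christoffel; congr (_ * _).
by apply: eq_bigr => l _; rewrite !partialB_warpBB.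
Qed.

Lemma christoffelB_BF k c i d z : cod a z -> Gam (bI k) (bI c) (fI i d) z = 0.
Proof.
move=> az; rewrite christoffelB// big1 ?mulr0// => l _.
by rewrite partial_warpFB partialF_warpBB partial_warpBF; ring.
Qed.

Lemma christoffelB_FB k c i d z : cod a z -> Gam (bI k) (fI i d) (bI c) z = 0.
Proof.
move=> az; rewrite christoffelB// big1 ?mulr0// => l _.
by rewrite !partial_warpFB partialF_warpBB; ring.
Qed.

Lemma christoffelB_FF k i c d z : cod a z ->
  Gam (bI k) (fI i c) (fI i d) z =
  - (w i (lsubmx z) * coord_grad i k (lsubmx z)) * gF i (a.2 i) (fib z i) c d.
Proof.
move=> az; rewrite christoffelB// mulNr /coord_grad.
rewrite [in RHS]mulr_sumr [in RHS]mulr_suml [LHS]mulr_sumr -sumrN.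
apply: eq_bigr => l _; rewrite !partial_warpFB partialB_warpFF//.
by field.
Qed.

Lemma christoffelB_FF_neq k i c j d z : cod a z -> i != j ->
  Gam (bI k) (fI i c) (fI j d) z = 0.
Proof.
move=> az ij; rewrite christoffelB// big1 ?mulr0// => l _.
by rewrite !partial_warpFB partial_warpFF_neq//; ring.
Qed.

Lemma christoffelF_BB i k c d z : cod a z -> Gam (fI i k) (bI c) (bI d) z = 0.
Proof.
move=> az; rewrite christoffelF// big1 ?mulr0// => l _.
by rewrite !partial_warpBF partialF_warpBB; ring.
Qed.

Lemma invmx_gF_mul i y c d : cod (a.2 i) y ->
  \sum_l invmx (gF i (a.2 i) y) c l * gF i (a.2 i) y d l = (c == d)%:R.
Proof.
move=> ay; have /matrixP/(_ c d) := mulVmx (unitF ay); rewrite !mxE => <-.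
by apply: eq_bigr => l _; rewrite (symF d l).
Qed.

Lemma christoffelF_BF i k c d z : cod a z ->
  Gam (fI i k) (bI c) (fI i d) z =
  (k == d)%:R * (partial c (w i) (lsubmx z) / w i (lsubmx z)).
Proof.
move=> az; have [_ zF] := az; rewrite christoffelF// -(invmx_gF_mul k d (zF i)).
rewrite mulr_suml mulr_sumr; apply: eq_bigr => l _.
rewrite !partial_warpBF partialB_warpFF//.
by field; exact: hb0.
Qed.

Lemma christoffelF_FB i k c d z : cod a z ->
  Gam (fI i k) (fI i d) (bI c) z =
  (k == d)%:R * (partial c (w i) (lsubmx z) / w i (lsubmx z)).
Proof.
move=> az; have [_ zF] := az; rewrite christoffelF// -(invmx_gF_mul k d (zF i)).
rewrite mulr_suml mulr_sumr; apply: eq_bigr => l _.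
rewrite !partial_warpBF !partial_warpFB partialB_warpFF//.
by field; exact: hb0.
Qed.

Lemma christoffelF_BF_neq i k c j d z : cod a z -> i != j ->
  Gam (fI i k) (bI c) (fI j d) z = 0.
Proof.
move=> az ij; rewrite christoffelF// big1 ?mulr0// => l _.
by rewrite !partial_warpBF partial_warpFF_neq 1?eq_sym//; ring.
Qed.

Lemma christoffelF_FB_neq i k c j d z : cod a z -> i != j ->
  Gam (fI i k) (fI j d) (bI c) z = 0.
Proof.
move=> az ij; rewrite christoffelF// big1 ?mulr0// => l _.
by rewrite !partial_warpBF !partial_warpFB partial_warpFF_neq 1?eq_sym//; ring.
Qed.

Lemma christoffelF_FF i k c d z : cod a z ->
  Gam (fI i k) (fI i c) (fI i d) z = christoffel (gF i) (a.2 i) k c d (fib z i).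
Proof.
move=> az; rewrite christoffelF// /christoffel; congr (_ * _).
apply: eq_bigr => l _; rewrite !partialF_warpFF//.
by field; exact: hb0.
Qed.

(** A Christoffel symbol with all indices in fibres needs them all in one
fibre: the metric has no entries between different fibres, and the block of F_j
depends on no fibre variable but that of F_j. *)
Lemma christoffelF_FF_neql i k j c l d z : cod a z -> i != j ->
  Gam (fI i k) (fI j c) (fI l d) z = 0.
Proof.
move=> az ij; rewrite christoffelF// big1 ?mulr0// => q _.
rewrite [X in _ + X - _]partial_warpFF_neq 1?eq_sym//.
have [il|il] := eqVneq i l.
  case: _ / il in d *; rewrite partialF_warpFF_neq 1?eq_sym//.
  by rewrite partial_warpFF_neq 1?eq_sym//; ring.
rewrite partial_warpFF_neq 1?eq_sym//.
have [jl|jl] := eqVneq j l; last by rewrite partial_warpFF_neq//; ring.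
by case: _ / jl in d il *; rewrite partialF_warpFF_neq//; ring.
Qed.

Lemma christoffelF_FF_neqr i k j c l d z : cod a z -> i != l ->
  Gam (fI i k) (fI j c) (fI l d) z = 0.
Proof.
move=> az il; rewrite christoffelF// big1 ?mulr0// => q _.
rewrite [X in X + _ - _]partial_warpFF_neq 1?eq_sym//.
have [ij|ij] := eqVneq i j.
  case: _ / ij in c *; rewrite partialF_warpFF_neq 1?eq_sym//.
  by rewrite partial_warpFF_neq//; ring.
rewrite partial_warpFF_neq 1?eq_sym//.
have [jl|jl] := eqVneq j l; last by rewrite partial_warpFF_neq//; ring.
by case: _ / jl in d il *; rewrite partialF_warpFF_neq//; ring.
Qed.

Local Notation Curv := (curvature (warped_metric gB gF b) a).

(** * Curvature of the warped metric *)

(** The inner product of the gradients of [b i] and [b j], as the derivative of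
[b j] along the gradient of [b i]. *)
Definition coord_inner i j (x : 'rV[R]_n) : R :=
  \sum_l coord_grad i l x * partial l (w j) x.

(** The trace of the covariant derivative of the gradient of [b i]; it is this
expression, and not the trace of the Hessian, that the curvature produces. *)
Definition coord_div i (x : 'rV[R]_n) : R :=
  \sum_k (partial k (coord_grad i k) x
          + \sum_l christoffel gB a.1 k k l x * coord_grad i l x).

Lemma derivable_partial_warp i x c e :
  cod a.1 x -> derivable (partial c (w i)) x (delta_mx 0 e).
Proof.
move=> ax; have hba := hb i a.1.
have hpa := smooth_on_partial c hba.
exact: smooth_on_derivable hpa ax.
Qed.

Lemma near_unitB x : cod a.1 x -> \forall y \near x, gB a.1 y \in unitmx.
Proof.
move=> ax; have [_ _ _ cB _] := hB; have [[_ oB] _ _ _ _] := cB a.1.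
by apply: filterS (open_nbhs_nbhs (conj oB ax)) => y; exact: unitB.
Qed.

Lemma derivable_coord_grad i k e x :
  cod a.1 x -> derivable (coord_grad i k) x (delta_mx 0 e).
Proof.
move=> ax; apply: derivable_sum_fun => l; apply: derivable_mul.
  by apply: (derivable_invmx (near_unitB ax)) => c d; exact: derivable_gB.
exact: derivable_partial_warp.
Qed.

Lemma curvatureB_B l k i j z : cod a z ->
  Curv (bI l) (bI k) (bI i) (bI j) z = curvature gB a.1 l k i j (lsubmx z).
Proof.
move=> az; rewrite /curvature big_block_ord [X in _ + (_ + X)]big1 ?addr0.
  congr (_ - _ + _).
  - rewrite (eq_partial_on _ az (fun y => @christoffelB_BB l j k y)).
    exact: (partial_base (christoffel gB a.1 l j k)).
  - rewrite (eq_partial_on _ az (fun y => @christoffelB_BB l i k y)).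
    exact: (partial_base (christoffel gB a.1 l i k)).
  - by apply: eq_bigr => c _; rewrite !(christoffelB_BB _ _ _ az).
move=> q _; apply: big1 => c _.
by rewrite !(christoffelB_BF _ _ _ az) !mul0r subrr.
Qed.

Lemma partial_div x (f g : 'rV[R]_n -> R) e :
  derivable f x (delta_mx 0 e) -> derivable g x (delta_mx 0 e) -> g x != 0 ->
  partial e (fun y => f y / g y) x =
  partial e f x / g x - f x * partial e g x / g x ^+ 2.
Proof.
move=> df dg g0; rewrite /partial.
rewrite (derive_mul df (derivableV g0 dg)) (deriveV g0 dg).
by rewrite /GRing.scale /=; field.
Qed.

(** The derivative of (d_k b_i) / b_i gives the second derivatives of [b i] and
a term (d_j b_i)(d_k b_i) / b_i^2, which the quadratic terms cancel. *)
Lemma curvatureF_B i c k j z : cod a z ->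
  Curv (fI i c) (bI k) (fI i c) (bI j) z =
  - (hessian gB (b i) a.1 (lsubmx z) j k / w i (lsubmx z)).
Proof.
move=> az; have [zB _] := az; rewrite /curvature.
rewrite (partial_cst_on _ az (fun y => @christoffelF_BB i c j k y)).
rewrite (eq_partial_on _ az (fun y => @christoffelF_FB i c k c y)).
rewrite eqxx mulr1n (partial_base (fun x => 1 * (partial k (w i) x / w i x))).
have dp := derivable_partial_warp (i := i) (c := k) (e := j) zB.
have dw := derivable_warp (i := i) (e := j) zB.
under [X in partial j X]eq_fun do rewrite mul1r.
rewrite partial_div ?hb0// big_block_ord.
rewrite [X in _ + (X + _)](_ : _ = \sum_l christoffel gB a.1 l j k (lsubmx z)
   * partial l (w i) (lsubmx z) / w i (lsubmx z)); last first.
  apply: eq_bigr => l _; rewrite (christoffelF_FB _ _ _ az).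
  by rewrite (christoffelB_BB _ _ _ az) (christoffelF_BB _ _ _ az) eqxx mulr1n; ring.
rewrite [X in _ + (_ + X)](_ : _ = - (partial j (w i) (lsubmx z) / w i (lsubmx z)
   * (partial k (w i) (lsubmx z) / w i (lsubmx z)))); last first.
  rewrite (bigD1 i)//= [X in _ + X]big1 ?addr0 => [|l li]; last first.
    apply: big1 => d _; rewrite (christoffelF_BB _ _ _ az).
    by rewrite (christoffelF_BF_neq _ _ _ az) 1?eq_sym//; ring.
  rewrite (bigD1 c)//= [X in _ + X]big1 ?addr0 => [|d dc].
    rewrite (christoffelF_BB _ _ _ az) (christoffelF_BF _ _ _ az).
    by rewrite (christoffelF_FB _ _ _ az) eqxx mulr1n; ring.
  rewrite (christoffelF_BB _ _ _ az) (christoffelF_BF _ _ _ az).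
  by rewrite eq_sym (negbTE dc) mulr0n; ring.
rewrite /hessian mxE mulrBl opprB mulr_suml.
by have := hb0 i (param a.1 (lsubmx z)) => w0; rewrite /comp; field.
Qed.

(** The derivative of b_i V_i^k leaves a term V_i^k d_k b_i, cancelled by the
product of Gamma^k_{(ic)(id)} with the mixed symbol Gamma^{(id)}_{k(id)}. *)
Lemma curvatureB_F k i c d z : cod a z ->
  Curv (bI k) (fI i d) (bI k) (fI i c) z =
  - (w i (lsubmx z) * (partial k (coord_grad i k) (lsubmx z)
      + \sum_l christoffel gB a.1 k k l (lsubmx z) * coord_grad i l (lsubmx z)))
  * gF i (a.2 i) (fib z i) c d.
Proof.
move=> az; have [zB _] := az; rewrite /curvature.
rewrite (eq_partial_on _ az (fun y => @christoffelB_FF k i c d y)).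
rewrite (partial_cst_on _ az (fun y => @christoffelB_BF k k i d y)).
have dv := derivable_coord_grad (i := i) (k := k) (e := k) zB.
have dw := derivable_warp (i := i) (e := k) zB.
rewrite (partial_base_mul (u := fun x => - (w i x * coord_grad i k x))
   (fun y => gF i (a.2 i) y c d)); last first.
  exact: (derivableN (derivable_mul dw dv)).
rewrite [partial k _ _](_ : _ = - (w i (lsubmx z) * partial k (coord_grad i k) (lsubmx z)
   + coord_grad i k (lsubmx z) * partial k (w i) (lsubmx z))); last first.
  have dwv := derivable_mul dw dv.
  by rewrite /partial (deriveN dwv) (derive_mul dw dv).
rewrite big_block_ord.
rewrite [X in _ + (X + _)](_ : _ = - (w i (lsubmx z) * \sum_l
    christoffel gB a.1 k k l (lsubmx z) * coord_grad i l (lsubmx z)) *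
    gF i (a.2 i) (fib z i) c d); last first.
  rewrite mulr_sumr -sumrN mulr_suml; apply: eq_bigr => l _.
  rewrite (christoffelB_BB _ _ _ az) (christoffelB_FF _ _ _ az).
  by rewrite (christoffelB_FB _ _ _ az); ring.
rewrite [X in _ + (_ + X)](_ : _ = coord_grad i k (lsubmx z) *
    partial k (w i) (lsubmx z) * gF i (a.2 i) (fib z i) c d); last first.
  rewrite (bigD1 i)//= [X in _ + X]big1 ?addr0 => [|l li]; last first.
    apply: big1 => e _; rewrite (christoffelB_BF _ _ _ az).
    by rewrite (christoffelB_FF_neq _ _ _ az) 1?eq_sym//; ring.
  rewrite (bigD1 d)//= [X in _ + X]big1 ?addr0 => [|e ed].
    rewrite (christoffelB_BF _ _ _ az) (christoffelB_FF _ _ _ az).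
    rewrite (christoffelF_BF _ _ _ az) eqxx mulr1n.
    by have := hb0 i (param a.1 (lsubmx z)) => w0; rewrite /comp; field.
  rewrite (christoffelB_BF _ _ _ az) (christoffelF_BF _ _ _ az).
  by rewrite (negbTE ed) mulr0n; ring.
by ring.
Qed.

Lemma curvatureF_F_neq j e i c d z : cod a z -> j != i ->
  Curv (fI j e) (fI i d) (fI j e) (fI i c) z =
  - (w i (lsubmx z) * coord_inner i j (lsubmx z) / w j (lsubmx z))
  * gF i (a.2 i) (fib z i) c d.
Proof.
move=> az ji; rewrite /curvature.
rewrite (partial_cst_on _ az (fun y hy => @christoffelF_FF_neql j e i c i d y hy ji)).
rewrite (partial_cst_on _ az (fun y hy => @christoffelF_FF_neqr j e j e i d y hy ji)).
rewrite big_block_ord [X in _ + (_ + X)]big1 ?addr0 => [|l _]; last first.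
  apply: big1 => q _; rewrite (christoffelF_FF_neql _ _ _ az ji) mul0r subr0.
  have [jl|jl] := eqVneq j l; last by rewrite (christoffelF_FF_neqr _ _ _ az jl) mul0r.
  by case: _ / jl in q *; rewrite (christoffelF_FF_neql _ _ _ az ji) mulr0.
rewrite subrr add0r /coord_inner mulr_sumr mulr_suml -sumrN mulr_suml.
apply: eq_bigr => l _; rewrite (christoffelF_FB _ _ _ az) eqxx mulr1n.
rewrite (christoffelB_FF _ _ _ az) (christoffelF_FB_neq _ _ _ az ji).
by ring.
Qed.

(** Besides the curvature of [F i] itself there is the contribution of the sums
over the base index, which joins the fibres to the variation of [b i]. *)
Lemma curvatureF_F i e c d z : cod a z ->
  Curv (fI i e) (fI i d) (fI i e) (fI i c) z =
  curvature (gF i) (a.2 i) e d e c (fib z i)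
  + coord_inner i i (lsubmx z) *
    ((e == c)%:R * gF i (a.2 i) (fib z i) e d - gF i (a.2 i) (fib z i) c d).
Proof.
move=> az; rewrite /curvature.
rewrite (eq_partial_on _ az (fun y => @christoffelF_FF i e c d y)).
rewrite (eq_partial_on _ az (fun y => @christoffelF_FF i e e d y)).
rewrite (partial_fib (christoffel (gF i) (a.2 i) e c d)).
rewrite (partial_fib (christoffel (gF i) (a.2 i) e e d)) -[RHS]addrA; congr (_ + _).
rewrite big_block_ord [RHS]addrC; congr (_ + _); last first.
  rewrite (bigD1 i)//= [X in _ + X]big1 ?addr0 => [|l li]; last first.
    rewrite eq_sym in li; apply: big1 => q _.
    by rewrite !(christoffelF_FF_neqr _ _ _ az li) !mul0r subrr.
  by apply: eq_bigr => q _; rewrite !(christoffelF_FF _ _ _ az).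
rewrite /coord_inner mulr_suml; apply: eq_bigr => l _.
rewrite !(christoffelF_FB _ _ _ az) !(christoffelB_FF _ _ _ az) eqxx mulr1n.
by have := hb0 i (param a.1 (lsubmx z)) => w0; rewrite /comp; field.
Qed.

(** * Ricci and scalar curvature in a product chart *)

Lemma coord_divE i x : cod a.1 x ->
  coord_div i x = \tr (invmx (gB a.1 x) *m hessian gB (b i) a.1 x).
Proof.
move=> ax.
have symP c d : invmx (gB a.1 x) c d = invmx (gB a.1 x) d c.
  have [_ _ /(_ a.1 x ax) symg _] := hgB.
  by rewrite -[in LHS]symg -trmx_inv mxE.
have symd e c d : partial e (fun y => gB a.1 y c d) x =
                  partial e (fun y => gB a.1 y d c) x.
  apply: near_eq_derive; have [_ _ _ cB _] := hB.
  have [[_ oB] _ _ _ _] := cB a.1.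
  by apply: filterS (open_nbhs_nbhs (conj oB ax)) => y; exact: symB.
have key := divergence_grad_algebra (fun l => partial l (w i) x)
  (fun k l => partial k (partial l (w i)) x) symP symd.
transitivity (\sum_k \sum_l invmx (gB a.1 x) k l * (partial l (partial k (w i)) x
   - \sum_e christoffel gB a.1 e l k x * partial e (w i) x)); last first.
  rewrite /mxtrace; apply: eq_bigr => k _; rewrite mxE; apply: eq_bigr => l _.
  by rewrite mxE.
rewrite -[RHS]key; apply: eq_bigr => k _; congr (_ + _).
have dP l : derivable (fun y => invmx (gB a.1 y) k l) x (delta_mx 0 k).
  by apply: (derivable_invmx (near_unitB ax)) => c d; exact: derivable_gB.
have dp l : derivable (partial l (w i)) x (delta_mx 0 k).
  exact: derivable_partial_warp.
rewrite /partial /coord_grad derive_sum_fun => [|l]; last exact: derivable_mul.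
apply: eq_bigr => l _; rewrite (derive_mul (dP l) (dp l)) addrC; congr (_ + _).
rewrite mulrC; congr (_ * _).
have dg c d : derivable (fun y => gB a.1 y c d) x (delta_mx 0 k).
  exact: derivable_gB.
by rewrite (derive_invmx (near_unitB ax) dg k l).
Qed.

Lemma ricciB_warped j k z : cod a z ->
  ricci (warped_metric gB gF b) a z (bI j) (bI k) =
  ricci gB a.1 (lsubmx z) j k
  - \sum_i (s i)%:R / w i (lsubmx z) * hessian gB (b i) a.1 (lsubmx z) j k.
Proof.
move=> az; rewrite /ricci !mxE big_block_ord -sumrN; congr (_ + _).
  by apply: eq_bigr => i _; exact: curvatureB_B.
apply: eq_bigr => i _; rewrite (eq_bigr _ (fun c _ => curvatureF_B c k j az)).
by rewrite sumr_const card_ord -mulr_natl; ring.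
Qed.

(** The coefficient K_i by which the Ricci tensor on the [F i]-block exceeds
that of [F i].  The base contributes - b_i div V_i, the fibre [F i] itself
(1 - s_i) |V_i|^2, and [F j] with j <> i contributes
- b_i s_j <V_i, grad b_j> / b_j; splitting off |V_i|^2 makes the sum run over
all j uniformly. *)
Definition fibre_ricci_coef i (x : 'rV[R]_n) : R :=
  coord_inner i i x - w i x * coord_div i x
  - w i x * \sum_j (s j)%:R * coord_inner i j x / w j x.

Lemma ricciF_warped i c d z : cod a z ->
  ricci (warped_metric gB gF b) a z (fI i c) (fI i d) =
  ricci (gF i) (a.2 i) (fib z i) c d
  + fibre_ricci_coef i (lsubmx z) * gF i (a.2 i) (fib z i) c d.
Proof.
move=> az; rewrite /ricci [LHS]mxE [X in _ = X + _]mxE big_block_ord.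
rewrite [X in _ + X = _](bigD1 i)//= /fibre_ricci_coef [X in _ - _ - _ * X](bigD1 i)//=.
rewrite (eq_bigr _ (fun k _ => curvatureB_F k c d az)).
rewrite -mulr_suml sumrN -mulr_sumr -/(coord_div i _).
rewrite (eq_bigr _ (fun e _ => curvatureF_F e c d az)) big_split /=.
have -> : \sum_(e < s i) coord_inner i i (lsubmx z) *
    ((e == c)%:R * gF i (a.2 i) (fib z i) e d - gF i (a.2 i) (fib z i) c d) =
    coord_inner i i (lsubmx z) * ((1 - (s i)%:R) * gF i (a.2 i) (fib z i) c d).
  rewrite -mulr_sumr sumrB sumr_const card_ord mulrBl mul1r mulr_natl.
  by rewrite sum_delta.
rewrite (_ : \sum_(j < m | j != i) _ = - (w i (lsubmx z) *
    (\sum_(j < m | j != i) (s j)%:R * coord_inner i j (lsubmx z) /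
      w j (lsubmx z))) * gF i (a.2 i) (fib z i) c d).
  by have := hb0 i (param a.1 (lsubmx z)) => w0; rewrite /comp; field.
rewrite mulr_sumr -sumrN mulr_suml; apply: eq_bigr => j ji.
rewrite (eq_bigr _ (fun e _ => curvatureF_F_neq e c d az ji)).
by rewrite sumr_const card_ord -mulr_natl; ring.
Qed.

Lemma trace_ricci_warped z : cod a z ->
  \tr (invmx (G z) *m ricci (warped_metric gB gF b) a z) =
  \tr (invmx (gB a.1 (lsubmx z)) *m ricci gB a.1 (lsubmx z))
  - \sum_i (s i)%:R / w i (lsubmx z) *
      \tr (invmx (gB a.1 (lsubmx z)) *m hessian gB (b i) a.1 (lsubmx z))
  + \sum_i (w i (lsubmx z) ^+ 2)^-1 *
      (\tr (invmx (gF i (a.2 i) (fib z i)) *m ricci (gF i) (a.2 i) (fib z i))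
       + (s i)%:R * fibre_ricci_coef i (lsubmx z)).
Proof.
move=> az; have [_ zF] := az; rewrite {1}/mxtrace big_block_ord; congr (_ + _).
  rewrite [X in _ - X](_ : _ = \sum_k \sum_l invmx (gB a.1 (lsubmx z)) k l *
     \sum_i (s i)%:R / w i (lsubmx z) * hessian gB (b i) a.1 (lsubmx z) l k).
    rewrite -sumrN -big_split; apply: eq_bigr => k _.
    rewrite [LHS]mxE [X in _ = X + _]mxE -sumrN -big_split big_block_ord.
    rewrite [X in _ + X]big1 ?addr0 => [|i _]; last first.
      by apply: big1 => c _; rewrite (invmx_warpBF _ _ az) mul0r.
    apply: eq_bigr => l _.
    by rewrite (invmx_warpBB _ _ az) (ricciB_warped _ _ az) mulrBr.
  transitivity (\sum_k \sum_i \sum_l (s i)%:R / w i (lsubmx z) *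
      (invmx (gB a.1 (lsubmx z)) k l * hessian gB (b i) a.1 (lsubmx z) l k)).
    rewrite exchange_big; apply: eq_bigr => i _; rewrite /mxtrace mulr_sumr.
    by apply: eq_bigr => k _; rewrite mxE mulr_sumr.
  apply: eq_bigr => k _; rewrite exchange_big; apply: eq_bigr => l _ /=.
  by rewrite mulr_sumr; apply: eq_bigr => i _; rewrite mulrCA.
apply: eq_bigr => i _.
transitivity (\sum_c \sum_d (w i (lsubmx z) ^+ 2)^-1 *
   (invmx (gF i (a.2 i) (fib z i)) c d * ricci (gF i) (a.2 i) (fib z i) d c
    + fibre_ricci_coef i (lsubmx z) *
      (invmx (gF i (a.2 i) (fib z i)) c d * gF i (a.2 i) (fib z i) c d))).
  apply: eq_bigr => c _; rewrite mxE big_block_ord big1 ?add0r => [|l _]; last first.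
    by rewrite (invmx_warpFB _ _ az) mul0r.
  rewrite (bigD1 i)//= [X in _ + X]big1 ?addr0 => [|j ji]; last first.
    apply: big1 => d _; rewrite (invmx_warpFF_neq _ _ az) ?mul0r// eq_sym//.
  apply: eq_bigr => d _; rewrite (invmx_warpFF _ _ az) (ricciF_warped _ _ az).
  by rewrite (symF c d (zF i)); ring.
transitivity (\sum_c (w i (lsubmx z) ^+ 2)^-1 *
   ((invmx (gF i (a.2 i) (fib z i)) *m ricci (gF i) (a.2 i) (fib z i)) c c
    + fibre_ricci_coef i (lsubmx z))).
  apply: eq_bigr => c _; rewrite -mulr_sumr big_split -mulr_sumr /=.
  by rewrite (invmx_gF_mul _ _ (zF i)) eqxx mulr1n mulr1 mxE.
by rewrite -mulr_sumr big_split /= sumr_const card_ord /mxtrace mulr_natl.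
Qed.

End WarpedProduct.

(** * Scalar curvature of a multiply warped product *)

Section ScalarCurvature.
Variables (R : realType) (n m : nat) (s : 'I_m -> nat).
Variables (B : charted_space R n) (gB : tensor2 B).
Variables (F : forall i : 'I_m, charted_space R (s i)).
Variables (gF : forall i : 'I_m, tensor2 (F i)) (b : 'I_m -> B -> R).
Arguments gF : clear implicits.
Hypotheses (hB : is_manifold B) (hgB : is_metric gB).
Hypotheses (hF : forall i, is_manifold (F i)).
Hypotheses (hgF : forall i, is_metric (gF i)).
Hypotheses (hb : forall i, smooth (b i)) (hb0 : forall i p, b i p != 0).

(** With D the row of partial derivatives, grad = D g^-1, so that
(D_i g^-1) g (D_j g^-1)^T = (D_i g^-1) D_j^T. *)
Lemma inner_gradE i j (a : chart (product_space B F)) (p : B) :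
  a.1 = chart_at p ->
  inner gB p (grad gB (b i) p) (grad gB (b j) p) =
  coord_inner gB b a i j (to_coord (chart_at p) p).
Proof.
move=> ap; rewrite /inner /grad /at_point.
set x := to_coord _ _; set D := fun i => \row_l partial l (b i \o param (chart_at p)) x.
have ax : cod (chart_at p) x by exact: cod_chart_at.
have [_ _ /(_ _ _ ax) symg /(_ _ _ ax) ug] := hgB.
rewrite -/(D i) -/(D j) trmx_mul trmx_inv symg !mulmxA mulmxKV//.
rewrite /coord_inner /coord_grad ap !mxE; apply: eq_bigr => l _.
rewrite !mxE; congr (_ * _); apply: eq_bigr => k _.
rewrite mxE mulrC; congr (_ * _).
by rewrite -[in LHS]symg -trmx_inv mxE.
Qed.

(** The chart in which tensors at [q] are evaluated is the product of those
chosen for its components, so that every quantity on the right is read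
off in the factors of one and the same chart. *)
Theorem scalar_curvature_warped (q : product_space B F) :
  scalar_curvature (warped_metric gB gF b) q =
  scalar_curvature gB q.1
  - 2 * \sum_i (s i)%:R / b i q.1 * laplacian gB (b i) q.1
  + \sum_i scalar_curvature (gF i) (q.2 i) / b i q.1 ^+ 2
  + \sum_i (s i)%:R / b i q.1 ^+ 2 *
      inner gB q.1 (grad gB (b i) q.1) (grad gB (b i) q.1)
  - \sum_i \sum_k (s i)%:R * (s k)%:R / (b i q.1 * b k q.1) *
      inner gB q.1 (grad gB (b i) q.1) (grad gB (b k) q.1).
Proof.
pose a := chart_at q; pose z := to_coord a q.
have zl : lsubmx z = to_coord (chart_at q.1) q.1 by exact: row_mxKl.
have zr i : submxrow (rsubmx z) i = to_coord (chart_at (q.2 i)) (q.2 i).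
  by rewrite /z /= row_mxKr mxrowK.
have az : cod a z.
  by split=> [|i]; rewrite ?zl ?zr; exact: cod_chart_at.
rewrite {1}/scalar_curvature /metric_trace {1 2}/at_point -/a -/z.
rewrite (trace_ricci_warped hB hgB hF hgF hb hb0 az) zl.
have bE i : (b i \o param a.1) (to_coord (chart_at q.1) q.1) = b i q.1.
  by rewrite /= param_chart_at.
have lapE i : \tr (invmx (gB a.1 (to_coord (chart_at q.1) q.1)) *m
    hessian gB (b i) a.1 (to_coord (chart_at q.1) q.1)) = laplacian gB (b i) q.1.
  by [].
have divE i : coord_div gB b a i (to_coord (chart_at q.1) q.1) =
    laplacian gB (b i) q.1.
  by rewrite (coord_divE hB hgB hb)//; exact: cod_chart_at.
have innE i j : coord_inner gB b a i j (to_coord (chart_at q.1) q.1) =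
    inner gB q.1 (grad gB (b i) q.1) (grad gB (b j) q.1).
  by rewrite (@inner_gradE i j a q.1).
rewrite -[X in X - _ + _]/(scalar_curvature gB q.1) -!addrA; congr (_ + _).
rewrite mulr_sumr -!sumrN -!big_split; apply: eq_bigr => i _.
rewrite lapE bE zr -[X in _ * (X + _)]/(scalar_curvature (gF i) (q.2 i)).
rewrite /fibre_ricci_coef divE innE bE /=.
rewrite (_ : \sum_(j < m) (s j)%:R * _ / _ = \sum_(k < m) (s k)%:R *
  inner gB q.1 (grad gB (b i) q.1) (grad gB (b k) q.1) / b k q.1); last first.
  by apply: eq_bigr => k _; rewrite innE /= param_chart_at.
rewrite (_ : \sum_(k < m) (s i)%:R * _ / _ * _ = (s i)%:R / b i q.1 *
  \sum_(k < m) (s k)%:R *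
  inner gB q.1 (grad gB (b i) q.1) (grad gB (b k) q.1) / b k q.1); last first.
  rewrite mulr_sumr; apply: eq_bigr => k _.
  by field; rewrite !hb0.
by field; exact: hb0.
Qed.

End ScalarCurvature.

Unset Implicit Arguments.
Set Strict Implicit.

Theorem theorem4p7 (R : realType) (n m : nat) (s : 'I_m -> nat)
    (B : charted_space R n) (gB : tensor2 B)
    (F : forall i : 'I_m, charted_space R (s i))
    (gF : forall i : 'I_m, tensor2 (F i))
    (lambda : B -> R) (b : 'I_m -> B -> R) (mu : 'I_m -> R)
    (hn : (2 <= n)%N) (hm : (1 <= m)%N) (hs : forall i, (0 < s i)%N)
    (hB : is_manifold B) (hgB : is_metric gB)
    (hF : forall i, is_manifold (F i)) (hgF : forall i, is_metric (gF i))
    (hlambda : smooth lambda)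
    (hb : forall i, smooth (b i)) (hb0 : forall i p, 0 < b i p)
    (hRicB : forall (a : chart B) x, cod a x ->
       ricci gB a x = lambda (param a x) *: gB a x
         + \sum_(i < m) ((s i)%:R / b i (param a x)) *: hessian gB (b i) a x)
    (hRicF : forall i, is_einstein (gF i) (mu i)) :
  let tau := scalar_curvature (warped_metric gB gF b) in
  let A i p :=
    (b i p) ^+ 2 *
      (\sum_(k < m) (s k)%:R *
          inner gB p ((b i p)^-1 *: grad gB (b i) p)
                     ((b k p)^-1 *: grad gB (b k) p)
       + laplacian gB (b i) p / b i p
       - inner gB p (grad gB (b i) p) (grad gB (b i) p) / (b i p) ^+ 2
       + lambda p)
    - mu i in
  forall q : product_space B F,
    \sum_(i < m) (s i)%:R * (1 / (b i q.1) ^+ 2) * A i q.1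
    = lambda q.1 * (n + \sum_(i < m) s i)%N%:R - tau q.
Proof.
move=> tau A q; have b0 i p : b i p != 0 by rewrite gt_eqF.
pose p := q.1; rewrite -/p.
have tauB : scalar_curvature gB p = lambda p * n%:R
    + \sum_i (s i)%:R / b i p * laplacian gB (b i) p.
  have cp := cod_chart_at p hB.
  have [_ _ _ /(_ _ _ cp) ug] := hgB.
  rewrite /scalar_curvature /laplacian /metric_trace /at_point hRicB//.
  rewrite param_chart_at// mulmxDr mxtraceD -scalemxAr mxtraceZ mulVmx// mxtrace1.
  congr (_ + _); rewrite mulmx_sumr raddf_sum; apply: eq_bigr => i _ /=.
  by rewrite -scalemxAr mxtraceZ.
have tauF i : scalar_curvature (gF i) (q.2 i) = mu i * (s i)%:R.
  have cy := cod_chart_at (q.2 i) (hF i).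
  have [_ _ _ /(_ _ _ cy) ug] := hgF i.
  rewrite /scalar_curvature /metric_trace /at_point hRicF//.
  by rewrite -scalemxAr mxtraceZ mulVmx// mxtrace1.
have innZ c d (u v : 'rV[R]_n) :
    inner gB p (c *: u) (d *: v) = c * d * inner gB p u v.
  by rewrite /inner linearZ /= -scalemxAr -!scalemxAl scalerA mxE (mulrC d).
rewrite /tau (scalar_curvature_warped hB hgB hF hgF hb b0) -/p tauB.
set I := fun i k => inner gB p (grad gB (b i) p) (grad gB (b k) p).
transitivity (\sum_i (
    \sum_k (s i)%:R * (s k)%:R / (b i p * b k p) * I i k
    + (s i)%:R / b i p * laplacian gB (b i) p
    - (s i)%:R / b i p ^+ 2 * I i i
    + lambda p * (s i)%:R - mu i * (s i)%:R / b i p ^+ 2)).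
  apply: eq_bigr => i _; rewrite /A.
  rewrite (_ : \sum_k (s i)%:R * (s k)%:R / (b i p * b k p) * I i k =
    (s i)%:R * \sum_(k < m) (s k)%:R *
     inner gB p ((b i p)^-1 *: grad gB (b i) p) ((b k p)^-1 *: grad gB (b k) p)).
    by rewrite /I; field; exact: b0.
  rewrite mulr_sumr; apply: eq_bigr => k _; rewrite innZ /I.
  by field; rewrite !b0.
under [X in _ - (_ + X + _ - _)]eq_bigr do rewrite tauF.
rewrite natrD natr_sum mulrDr [lambda p * \sum_i _]mulr_sumr.
rewrite !sumrB !big_split /= !sumrN /I.
by ring.
Qed.
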